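(* Let $I$ be a countable set, $\{G_i:i\in I\}$ a family of finite abelian groups (each with the discrete topology) and $G=\prod_{i\in I}G_i$ its direct product with the Tychonoff product topology. Then every closed weakly controllable subgroup $H$ of $G$ is topologically isomorphic to a direct product of finite cyclic groups.
   Context: $\bigoplus_{i\in I}G_i$ denotes the subgroup of all $g\in\prod_{i\in I}G_i$ such that $g(i)$ is the identity of $G_i$ for all but finitely many $i\in I$. A subgroup $H$ of $G=\prod_{i\in I}G_i$ is weakly controllable in $G$ if $H\cap\bigoplus_{i\in I}G_i$ is dense in $H$. Finite cyclic groups carry the discrete topology, and direct products the Tychonoff product topology; ''topologically isomorphic'' means isomorphic via a group isomorphism that is a homeomorphism. *)

(* Defs.v *)
From HB Require Import structures.
From mathcomp Require Import all_boot all_order all_algebra all_fingroup.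
From mathcomp Require Import all_solvable.
From mathcomp Require Import all_classical all_reals all_analysis.

Set Implicit Arguments.
Unset Strict Implicit.
Unset Printing Implicit Defensive.

Import GRing.Theory.
Local Open Scope classical_set_scope.
Local Open Scope ring_scope.

(* All groups here are abelian and written additively. *)

Section DirectProduct.
Variables (I : Type) (G : I -> finZmodType).

Definition direct_prod : Type :=
  prod_topology (fun i => discrete_topology (G i)).

HB.instance Definition _ := Topological.on direct_prod.

Let add (f g : direct_prod) : direct_prod := fun i => (f i : G i) + g i.
Let opp (f : direct_prod) : direct_prod := fun i => - (f i : G i).
Let zero : direct_prod := fun i => 0 : G i.

Let addA : associative add.
Proof.
by move=> f g h; apply: functional_extensionality_dep => i; exact: addrA. Qed.

Let addC : commutative add.
Proof. by move=> f g; apply: functional_extensionality_dep => i; exact: addrC. Qed.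

Let add0 : left_id zero add.
Proof. by move=> f; apply: functional_extensionality_dep => i; exact: add0r. Qed.

Let addN : left_inverse zero opp add.
Proof. by move=> f; apply: functional_extensionality_dep => i; exact: addNr. Qed.

HB.instance Definition _ := GRing.isZmodule.Build direct_prod addA addC add0 addN.

Definition direct_sum : set direct_prod :=
  [set g | finite_set [set i | g i <> (0 : G i)]].

End DirectProduct.

Arguments direct_sum {I} G.

Record subgroup (V : zmodType) := Subgroup {
  subgroup_set :> set V;
  subgroup_closed : zmod_closed (mem subgroup_set) }.

Section SubgroupType.
Variables (V : PreTopologicalZmodule.type) (H : subgroup V).

Definition subgroup_type : Type := set_type (H : set V).

(* the subspace topology *)
HB.instance Definition _ := Topological.on subgroup_type.

Let mem0 : (0 : V) \in (H : set V).
Proof. by case: (subgroup_closed H). Qed.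

Let memB (x y : V) : x \in (H : set V) -> y \in (H : set V) ->
  x - y \in (H : set V).
Proof. by move=> Hx Hy; case: (subgroup_closed H) => _; exact. Qed.

Let memN (x : V) : x \in (H : set V) -> - x \in (H : set V).
Proof. by move=> Hx; rewrite -[- x]add0r; exact: memB. Qed.

Let memD (x y : V) : x \in (H : set V) -> y \in (H : set V) ->
  x + y \in (H : set V).
Proof. by move=> Hx Hy; rewrite -[y]opprK; apply: memB => //; exact: memN. Qed.

Let add (x y : subgroup_type) : subgroup_type :=
  exist _ (val x + val y) (memD (valP x) (valP y)).
Let opp (x : subgroup_type) : subgroup_type :=
  exist _ (- val x) (memN (valP x)).
Let zero : subgroup_type := exist _ 0 mem0.

Let addA : associative add.
Proof. by move=> x y z; apply: val_inj; exact: addrA. Qed.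

Let addC : commutative add.
Proof. by move=> x y; apply: val_inj; exact: addrC. Qed.

Let add0 : left_id zero add.
Proof. by move=> x; apply: val_inj; exact: add0r. Qed.

Let addN : left_inverse zero opp add.
Proof. by move=> x; apply: val_inj; exact: addNr. Qed.

HB.instance Definition _ :=
  GRing.isZmodule.Build subgroup_type addA addC add0 addN.

End SubgroupType.

Definition weakly_controllable (I : Type) (G : I -> finZmodType)
    (H : subgroup (direct_prod G)) : Prop :=
  dense (set_val @^-1` direct_sum G : set (subgroup_type H)).

Definition topologically_isomorphic (U V : PreTopologicalZmodule.type) : Prop :=
  exists (f : {additive U -> V}) (g : V -> U),
    [/\ cancel f g, cancel g f, continuous f & continuous g].

(* Main.v *)
Require Import Defs.
From HB Require Import structures.
From mathcomp Require Import all_boot all_order all_algebra all_fingroup.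
From mathcomp Require Import all_solvable.
From mathcomp Require Import all_classical all_reals all_analysis.

(** The idea is to peel finite cyclic direct summands off [H], one after the
other, until nothing is left.  Dually this is the theorem of Pruefer that a
countable torsion abelian group without elements of infinite height is a
direct sum of cyclic groups; the proof below stays on the compact side and
uses no duality.

Let [U n] be the open subgroup of the elements that vanish on the first [n]
coordinates.  From the product, only the formal properties of [U] collected in
[compact_filtration] matter, and from [H] only that it is a closed subgroup in
which the elements of finite order are dense: a finitely supported element has
finite order because all the factors are finite.  Both properties pass to
relatively open subgroups, so that the peeling can go on ([admissible_open]).

The heart is [split_step].  If [V] is such a subgroup, not contained in [U n],
then some prime [p] satisfies [V <> M] for [M = (V :&: U n) + p V].  By density
[V] has elements of [p]-power order outside [M]; let [z] be one of least order
[p ^ m.+1].  All elements of [V] killed by [p ^ m] are then in [M], and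
compactness strengthens this: for some [r], whenever [p ^ m x] is in [U r],
[x] is in [M].  Hence [w = p ^ m z] lies outside [p ^ m M + (V :&: U r)].  Let
[K] be maximal among the subgroups of [V] that contain the latter and avoid
[w].  Every nonzero subgroup of [V / K] contains [w], and [p ^ m.+1] kills
[V / K]; this forces [V = K (+) <z>] ([maximal_avoiding_complement]).
Moreover [z] is not in [K + U n], so that [K] is smaller than [V] modulo
[U n].

Iterating gives a decreasing sequence of open subgroups [V s] with
[V s = V s.+1 (+) <z s>].  If every [n] is treated infinitely often, the [V s]
become arbitrarily small: an infinite sequence of strict drops modulo [U n]
contradicts compactness ([exists_splitting_tower]).  Every [x] in [H] is then
the sum of a unique series of multiples of the [z s], every such series
converges in [H], and two elements are close exactly when many of their
initial coefficients agree.  So the coefficients are the wanted isomorphism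
onto the product of the cyclic groups generated by the [z s]. *)

Set Implicit Arguments.
Unset Strict Implicit.
Unset Printing Implicit Defensive.

Import GRing.Theory.
Local Open Scope classical_set_scope.
Local Open Scope ring_scope.

(** * Subgroups of an abelian group *)

Definition is_subgroup (P : zmodType) (V : set P) :=
  V 0 /\ forall x y, V x -> V y -> V (x - y).

Section Subgroups.
Variables (P : zmodType) (V : set P).
Hypothesis sgV : is_subgroup V.

Lemma sg0 : V 0. Proof. by case: sgV. Qed.
Lemma sgB x y : V x -> V y -> V (x - y). Proof. by case: sgV => _; exact. Qed.
Lemma sgN x : V x -> V (- x).
Proof. by move=> Vx; rewrite -[- x]sub0r; apply: sgB => //; exact: sg0. Qed.
Lemma sgD x y : V x -> V y -> V (x + y).
Proof. by move=> Vx Vy; rewrite -[y]opprK; apply: sgB => //; exact: sgN. Qed.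
Lemma sgMn x n : V x -> V (x *+ n).
Proof.
by move=> Vx; elim: n => [|n IHn]; [exact: sg0 | rewrite mulrS; exact: sgD].
Qed.
Lemma sgMz x (a : int) : V x -> V (x *~ a).
Proof. by case: a => n Vx; [exact: sgMn | apply/sgN/sgMn]. Qed.

Lemma sg_coprime x (a b : int) :
  coprimez a b -> V (x *~ a) -> V (x *~ b) -> V x.
Proof.
move=> /coprimezP[[u v] /= uv1] Vxa Vxb.
rewrite -[x]mulr1z -uv1 mulrzDr ![_ * a]mulrC ![_ * b]mulrC !mulrzA.
by apply: sgD; exact: sgMz.
Qed.

End Subgroups.

(** The subgroup generated by [K] and [z]. *)
Definition adjoin (P : zmodType) (K : set P) (z : P) : set P :=
  [set x | exists a : int, K (x - z *~ a)].

Section Adjoin.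
Variables (P : zmodType) (K : set P) (z : P).
Hypothesis sgK : is_subgroup K.

Lemma adjoin_subgroup : is_subgroup (adjoin K z).
Proof.
split; first by exists 0; rewrite subr0; exact: sg0.
move=> x y [a Kx] [b Ky]; exists (a - b).
have -> : x - y - z *~ (a - b) = (x - z *~ a) - (y - z *~ b).
  by rewrite mulrzBr !opprD addrACA.
exact: sgB.
Qed.

Lemma sub_adjoin : K `<=` adjoin K z.
Proof. by move=> x Kx; exists 0; rewrite subr0. Qed.

Lemma mem_adjoin : adjoin K z z.
Proof. by exists 1; rewrite mulr1z subrr; exact: sg0. Qed.

End Adjoin.

Lemma adjoin_sub (P : zmodType) (K V : set P) (z : P) :
  is_subgroup V -> K `<=` V -> V z -> adjoin K z `<=` V.
Proof.
move=> sgV KV Vz x [a /KV Vxa]; rewrite -[x](subrK (z *~ a)).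
by apply: (sgD sgV) => //; exact: (sgMz sgV).
Qed.

(** Zorn's lemma; maximality is stated as it is used: adjoining any further
element of [V] captures [w]. *)
Lemma exists_maximal_avoiding (P : zmodType) (V K0 : set P) (w : P) :
    is_subgroup V -> is_subgroup K0 -> K0 `<=` V -> ~ K0 w ->
  exists K : set P,
    [/\ is_subgroup K, K0 `<=` K, K `<=` V, ~ K w &
        forall x, V x -> ~ K x -> adjoin K x w].
Proof.
move=> sgV sgK0 K0V K0w.
(* The empty set is admitted as a candidate because it is the union of the
     empty chain. *)
pose good (K : set P) :=
  K = set0 \/ [/\ is_subgroup K, K0 `<=` K, K `<=` V & ~ K w].
have [|K [[->|[sgK K0K KV Kw]] Kmax]] := @Zorn_bigcup P good.
- move=> F Fgood Ftot.
  have [[X [FX X0]]|noX] := pselect (exists X, F X /\ X <> set0); last first.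
    left; rewrite -subset0 => x [X FX Xx]; case: noX; exists X; split => //.
    by move=> X0; rewrite X0 in Xx.
  right.
  have member Y y : F Y -> Y y ->
      [/\ is_subgroup Y, K0 `<=` Y, Y `<=` V & ~ Y w].
    by move=> FY Yy; have [Y0|//] := Fgood _ FY; rewrite Y0 in Yy.
  have [x0 Xx0] : X !=set0 by apply/set0P/eqP.
  have [sgX K0X _ _] := member _ _ FX Xx0.
  split.
  + split; first by exists X => //; exact: sg0.
    move=> x y [Y FY Yx] [Z FZ Zy].
    have [YZ|ZY] := Ftot _ _ FY FZ.
      have [sgZ _ _ _] := member _ _ FZ Zy.
      by exists Z => //; apply: (sgB sgZ) => //; exact: YZ.
    have [sgY _ _ _] := member _ _ FY Yx.
    by exists Y => //; apply: (sgB sgY) => //; exact: ZY.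
  + by move=> x K0x; exists X => //; exact: K0X.
  + by move=> x [Y FY Yx]; have [_ _ + _] := member _ _ FY Yx; exact.
  + by move=> [Y FY Yw]; have [_ _ _] := member _ _ FY Yw; exact.
- exfalso; apply: (Kmax K0); last by right; split.
  split; first exact: sub0set.
  by move=> /(_ 0 (sg0 sgK0)).
exists K; split => // x Vx Kx; apply: contrapT => Kxw.
apply: (Kmax (adjoin K x)).
  split; first exact: sub_adjoin.
  by move=> /(_ x (mem_adjoin _ sgK)).
right; split => //.
- exact: adjoin_subgroup.
- exact: subset_trans K0K (sub_adjoin _).
- exact: adjoin_sub.
Qed.

(** In [V / K] every nonzero subgroup contains [w = p ^ m z].  If some [x] were
outside [K + <z>], replace it by a multiple [y] by a power of [p] with
[p y = k + c z].  For [p] not dividing [c], multiplication by [p ^ m] would put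
[w] in [K].  For [c = p c'], the element [t = y - c' z] has [p t] in [K], so
that [w] is a multiple of [t] modulo [K] by a factor prime to [p], and [t]
itself is in [K + <z>], hence so is [y]. *)
Lemma maximal_avoiding_complement (P : zmodType) (V K : set P) (z : P)
    (p m : nat) :
    prime p -> is_subgroup V -> is_subgroup K -> K `<=` V -> V z ->
    (forall x, V x -> K (x *+ (p ^ m.+1))) ->
    ~ K (z *+ (p ^ m)) ->
    (forall x, V x -> ~ K x -> adjoin K x (z *+ (p ^ m))) ->
  V `<=` adjoin K z.
Proof.
move=> pp sgV sgK KV Vz pmV Kw maxK x Vx; apply: contrapT => Lx.
have sgL := adjoin_subgroup z sgK.
have Lw : adjoin K z (z *+ (p ^ m)) by apply: (sgMn sgL); exact: mem_adjoin.
have exj : exists j, `[< adjoin K z (x *+ (p ^ j)) >].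
  by exists m.+1; apply/asboolP/(sub_adjoin z)/pmV.
case: (ex_minnP exj) => -[|j] /asboolP Lpj jmin.
  by apply: Lx; rewrite expn0 in Lpj.
set y := x *+ (p ^ j).
have Ly : ~ adjoin K z y.
  by move=> Ly; have := jmin j; rewrite ltnn => /(_ (asboolT Ly)).
have Vy : V y by exact: sgMn.
rewrite expnS mulnC mulrnA -/y in Lpj; case: Lpj => c Kc.
have [/dvdzP[c' c'E]|pc] := boolP (p%:Z %| c)%Z.
  pose t := y - z *~ c'.
  have Kpt : K (t *+ p) by rewrite mulrnBl [X in _ - X]pmulrn -mulrzA -c'E.
  have Lt : ~ adjoin K z t.
    move=> Lt; apply: Ly; rewrite -[y](subrK (z *~ c')).
    by apply: (sgD sgL) => //; apply: (sgMz sgL); exact: mem_adjoin.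
  have Vt : V t by apply: (sgB sgV) => //; exact: sgMz.
  have [a Ka] := maxK t Vt (fun Kt => Lt (sub_adjoin z Kt)).
  have [/dvdzP[a' a'E]|pa] := boolP (p%:Z %| a)%Z.
    apply: Kw; rewrite -[z *+ _](subrK (t *~ a)); apply: (sgD sgK) => //.
    by rewrite a'E mulrC mulrzA -pmulrn; exact: sgMz.
  apply: Lt; apply: (sg_coprime sgL (a := p) (b := a)).
  - by rewrite coprimezE prime_coprime.
  - by rewrite -pmulrn; exact: sub_adjoin.
  - rewrite -[t *~ a](subKr (z *+ (p ^ m))); apply: (sgB sgL) => //.
    exact: sub_adjoin.
apply: Kw; apply: (sg_coprime sgK (a := p) (b := c)).
- by rewrite coprimezE prime_coprime.
- by rewrite -pmulrn -mulrnA -expnSr; exact: pmV.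
have -> : z *+ (p ^ m) *~ c = y *+ p *+ (p ^ m) - (y *+ p - z *~ c) *+ (p ^ m).
  by rewrite -mulrnBl subKr !pmulrn -!mulrzA mulrC.
apply: (sgB sgK); last exact: sgMn.
by rewrite -mulrnA -expnS; exact: pmV.
Qed.

Lemma dvdn_order (P : zmodType) (K : set P) (z : P) (p m a : nat) :
    prime p -> is_subgroup K -> K (z *+ (p ^ m.+1)) -> ~ K (z *+ (p ^ m)) ->
  K (z *+ a) -> (p ^ m.+1 %| a)%N.
Proof.
move=> pp sgK Kz Kw Ka; have [->//|a0] := posnP a.
have Kg : K (z *+ gcdn a (p ^ m.+1)).
  case: (egcdnP (p ^ m.+1) a0) => u v uE _.
  have -> : z *+ gcdn a (p ^ m.+1) = z *+ a *+ u - z *+ (p ^ m.+1) *+ v.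
    rewrite -!mulrnA [(a * u)%N]mulnC uE mulrnDr [(v * _)%N]mulnC.
    by rewrite addrC addKr.
  by apply: (sgB sgK); exact: (sgMn sgK).
have /(dvdn_pfactor _ _ pp)[j jm jE] := dvdn_gcdr a (p ^ m.+1).
move: jm; rewrite leq_eqVlt => /orP[/eqP jm|jm].
  by rewrite -jm -jE dvdn_gcdl.
exfalso; apply: Kw; rewrite ltnS in jm.
by rewrite -(subnKC jm) expnD mulrnA -jE; exact: (sgMn sgK).
Qed.

Lemma chain_subset (T : Type) (V : nat -> set T) s t :
  (forall k, V k.+1 `<=` V k) -> (s <= t)%N -> V t `<=` V s.
Proof.
move=> decV /subnK <-; elim: (t - s)%N => // k IHk.
exact: subset_trans (decV _) IHk.
Qed.

(** * Splitting off a finite cyclic summand *)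

(** The traces on algebra of a compact group topology with a countable basis of
open subgroups [U n] at zero: separation, finite exponent of the quotients by
[U n], and, in place of compactness, the existence of a point adherent to
every member of a decreasing sequence of nonempty sets. *)
Record compact_filtration (P : zmodType) (U : nat -> set P) : Prop := {
  filt_subgroup : forall n, is_subgroup (U n);
  filt_decreasing : forall m n, (m <= n)%N -> U n `<=` U m;
  filt_separated : forall x, (forall n, U n x) -> x = 0;
  filt_exponent : forall n, exists2 N, (0 < N)%N & forall x, U n (x *+ N);
  filt_compact : forall F : nat -> set P,
    (forall n, F n !=set0) -> (forall m n, (m <= n)%N -> F n `<=` F m) ->
    exists x, forall n, exists2 y, F n y & U n (x - y) }.

Section Filtration.
Variables (P : zmodType) (U : nat -> set P).
Hypothesis filtU : compact_filtration U.

Let sgU := filt_subgroup filtU.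
Let decU := filt_decreasing filtU.

Definition torsion_dense (V : set P) := forall v n, V v ->
  exists d, [/\ V d, exists2 N, (0 < N)%N & d *+ N = 0 & U n (v - d)].

Definition adherence_closed (V : set P) := forall x,
  (forall n, exists2 y, V y & U n (x - y)) -> V x.

(** What is kept of [H] and handed down to the successive complements. *)
Record admissible (V : set P) : Prop := {
  adm_subgroup : is_subgroup V;
  adm_dense : torsion_dense V;
  adm_closed : adherence_closed V }.

(** [V] is the direct sum of [K], which is relatively open, and of the cyclic
group generated by [z], whose order is [N.+1]; the successor makes that order
positive and ['I_N.+1] a group. *)
Record splits_off (V K : set P) (z : P) (N : nat) : Prop := {
  split_sub : K `<=` V;
  split_mem : V z;
  split_open : exists r, V `&` U r `<=` K;
  split_tors : z *+ N.+1 = 0;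
  split_meet : forall a, K (z *+ a) -> (N.+1 %| a)%N;
  split_sum : forall x, V x -> exists a, K (x - z *+ a) }.

Lemma admissible_open (V K : set P) r :
    admissible V -> is_subgroup K -> K `<=` V -> V `&` U r `<=` K ->
  admissible K.
Proof.
move=> [sgV denseV closedV] sgK KV VrK; split => //.
- move=> v n Kv.
  have [d [Vd torsd Ud]] := denseV v (maxn n r) (KV _ Kv).
  have Uvd m : (m <= maxn n r)%N -> U m (v - d) by move=> le; apply: decU Ud.
  exists d; split => //; last by apply: Uvd; rewrite leq_maxl.
  rewrite -[d](subKr v); apply: (sgB sgK) => //; apply: VrK; split.
    by apply: (sgB sgV) => //; exact: KV.
  by apply: Uvd; rewrite leq_maxr.
- move=> x Kx; have Vx : V x.
    by apply: closedV => n; have [y /KV Vy Uy] := Kx n; exists y.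
  have [y Ky Uy] := Kx r.
  rewrite -[x](subrK y); apply: (sgD sgK) => //; apply: VrK; split => //.
  by apply: (sgB sgV) => //; exact: KV.
Qed.

(** Take for [p] a prime factor of the exponent [N] of [V] modulo [U n]: if every
[v] were of the form [p x] modulo [U n], then [N / p] would already kill [V]
modulo [U n]. *)
Lemma exists_proper_prime_multiple (V : set P) n :
    is_subgroup V -> ~ V `<=` U n ->
  exists2 p, prime p &
    exists2 v, V v & forall x, V x -> ~ U n (v - x *+ p).
Proof.
move=> sgV VU.
have exN : exists N, (0 < N)%N && `[< forall x, V x -> U n (x *+ N) >].
  have [N N0 UN] := filt_exponent filtU n.
  by exists N; rewrite N0; apply/asboolP => x _; exact: UN.
case: (ex_minnP exN) => N /andP[N0 /asboolP UN] Nmin.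
have N1 : (1 < N)%N.
  rewrite ltn_neqAle N0 andbT eq_sym; apply/eqP => NE; apply: VU => x Vx.
  by rewrite -[x]mulr1n -NE; exact: UN.
exists (pdiv N); first exact: pdiv_prime.
apply: contrapT => noV.
have VpV v : V v -> exists2 x, V x & U n (v - x *+ pdiv N).
  move=> Vv; apply: contrapT => nox; apply: noV; exists v => // x Vx Ux.
  by apply: nox; exists x.
have: (N <= N %/ pdiv N)%N; last first.
  by rewrite leqNgt ltn_Pdiv // prime_gt1 // pdiv_prime.
apply: Nmin; rewrite divn_gt0 ?pdiv_gt0 // dvdn_leq ?pdiv_dvd //=.
apply/asboolP => v /VpV[x Vx Ux].
have -> : v *+ (N %/ pdiv N) = (v - x *+ pdiv N) *+ (N %/ pdiv N) + x *+ N.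
  by rewrite mulrnBl -mulrnA [(pdiv N * _)%N]mulnC divnK ?pdiv_dvd // subrK.
by apply: (sgD (sgU n)); [exact: (sgMn (sgU n)) | exact: UN].
Qed.

(** The subgroup [k A + (V :&: U n)]. *)
Definition near_multiples (V A : set P) k n :=
  [set x | V x /\ exists2 y, A y & U n (x - y *+ k)].

Section NearMultiples.
Variables (V A : set P) (k n : nat).
Hypotheses (sgV : is_subgroup V) (sgA : is_subgroup A).

Lemma near_multiples_subgroup : is_subgroup (near_multiples V A k n).
Proof.
split.
  split; first exact: sg0.
  exists 0; first exact: sg0.
  by rewrite mul0rn subr0; exact: sg0.
move=> x y [Vx [x' Ax' Ux']] [Vy [y' Ay' Uy']].
split; first exact: sgB.
exists (x' - y'); first exact: sgB.
have -> : x - y - (x' - y') *+ k = (x - x' *+ k) - (y - y' *+ k).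
  by rewrite mulrnBl !opprD addrACA.
exact: sgB.
Qed.

Lemma near_multiplesMn x : A `<=` V -> A x -> near_multiples V A k n (x *+ k).
Proof.
move=> AV Ax; split; first by apply: (sgMn sgV); exact: AV.
by exists x => //; rewrite subrr; exact: sg0.
Qed.

Lemma near_multiples_small : V `&` U n `<=` near_multiples V A k n.
Proof.
move=> x [Vx Ux]; split => //; exists 0; first exact: sg0.
by rewrite mul0rn subr0.
Qed.

End NearMultiples.

(** If there were no such [r], some [x] in [V] would be adherent to the elements
outside [M] with [p ^ m]-multiples tending to zero; then [p ^ m x = 0], so [x]
is in [M], whereas [M] is open. *)
Lemma uniform_annihilation (V M : set P) q n :
    admissible V -> is_subgroup M -> V `&` U n `<=` M ->
    (forall x, V x -> x *+ q = 0 -> M x) ->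
  exists r, forall x, V x -> U r (x *+ q) -> M x.
Proof.
move=> [sgV _ closedV] sgM UM qM; apply: contrapT => nor.
pose F r := [set x | [/\ V x, U r (x *+ q) & ~ M x]].
have [r|i j ij x [Vx Ux Mx]|x xP] := filt_compact filtU (F := F).
- apply: contrapT => F0; apply: nor; exists r => x Vx Ux.
  by apply: contrapT => Mx; apply: F0; exists x.
- by split => //; exact: decU Ux.
have Vx : V x by apply: closedV => k; have [y [Vy _ _] Uy] := xP k; exists y.
have Mx : M x.
  apply: qM => //; apply: (filt_separated filtU) => k.
  have [y [Vy Uy _] Uxy] := xP k.
  rewrite -[x](subrK y) mulrnDl; apply: (sgD (sgU k)) => //.
  exact: (sgMn (sgU k)).
have [y [Vy _ My] Uxy] := xP n; apply: My.
rewrite -[y](subKr x); apply: (sgB sgM) => //; apply: UM; split => //.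
exact: sgB.
Qed.

(** The order of [z] is least possible, so the elements of [V] killed by [p ^ m]
are all in [M]; this keeps [w] out of [p ^ m M] up to small elements, while
[p V] inside [M] lets [p ^ m.+1] kill [V / K].  The last clause, which says
that [K] is smaller than [V] modulo [U n], holds because [z = k + x] with [k]
in [K] and [x] in [M] would put [w] in [K]. *)
Lemma split_step (V : set P) n : admissible V -> ~ V `<=` U n ->
  exists K z N, [/\ admissible K, splits_off V K z N &
                    forall k, K k -> ~ U n (z - k)].
Proof.
move=> admV VU; have [sgV denseV closedV] := admV.
have [p pp [v Vv vP]] := exists_proper_prime_multiple sgV VU.
pose M := near_multiples V V p n.
have sgM : is_subgroup M by exact: near_multiples_subgroup.
have MV : M `<=` V by move=> x [].
have pM x : V x -> M (x *+ p) by exact: near_multiplesMn.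
have UM : V `&` U n `<=` M by exact: near_multiples_small.
have exm : exists m, `[< exists2 z, V z /\ ~ M z & z *+ (p ^ m) = 0 >].
  have [d [Vd [N N0 dN] Ud]] := denseV v n Vv.
  have Md : ~ M d.
    move=> Md; have [_ [y Vy Uy]] : M v.
      rewrite -[v](subrK d); apply: (sgD sgM) => //; apply: UM; split => //.
      exact: sgB.
    exact: vP Uy.
  (* The [p]-primary part of [d] stays outside [M], because [M] contains the
     multiples of [p]. *)
  have [q copq NE] := pfactor_coprime pp N0.
  exists (logn p N); apply/asboolP; exists (d *+ q); last first.
    by rewrite -mulrnA -NE.
  split; first exact: sgMn.
  move=> Mdq; apply: Md; apply: (sg_coprime sgM (a := p) (b := q)).
  - by rewrite coprimezE.
  - by rewrite -pmulrn; exact: pM.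
  - by rewrite -pmulrn.
case: (ex_minnP exm) => -[|m] /asboolP[z [Vz Mz] zm] mmin.
  by case: Mz; rewrite expn0 mulr1n in zm; rewrite zm; exact: sg0.
have mM x : V x -> x *+ (p ^ m) = 0 -> M x.
  move=> Vx xm; apply: contrapT => Mx.
  by have /mmin : `[< exists2 z, V z /\ ~ M z & z *+ (p ^ m) = 0 >];
    [apply/asboolP; exists x | rewrite ltnn].
have [r rM] := uniform_annihilation admV sgM UM mM.
pose K0 := near_multiples V M (p ^ m) r.
have sgK0 : is_subgroup K0 by exact: near_multiples_subgroup.
have K0w : ~ K0 (z *+ (p ^ m)).
  move=> [_ [y My Uy]]; apply: Mz; rewrite -[z](subrK y).
  apply: (sgD sgM) => //; apply: rM; last by rewrite mulrnBl.
  by apply: (sgB sgV) => //; exact: MV.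
have MK0 x : M x -> K0 (x *+ (p ^ m)) by exact: near_multiplesMn.
have [K [sgK K0K KV Kw maxK]] :=
  exists_maximal_avoiding sgV sgK0 (fun x => @proj1 _ _) K0w.
have rK : V `&` U r `<=` K.
  by apply: subset_trans K0K; exact: near_multiples_small.
have pmK x : V x -> K (x *+ (p ^ m.+1)).
  by move=> Vx; rewrite expnS mulrnA; apply/K0K/MK0/pM.
have VKz := maximal_avoiding_complement pp sgV sgK KV Vz pmK Kw maxK.
have pm0 : (0 < p ^ m.+1)%N by rewrite expn_gt0 prime_gt0.
have pmE : (p ^ m.+1).-1.+1 = (p ^ m.+1)%N by rewrite prednK.
exists K, z, (p ^ m.+1).-1; split.
- exact: admissible_open rK.
- split => //; rewrite ?pmE //; first by exists r.
    by move=> a; apply: dvdn_order => //; exact: pmK.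
  move=> x /VKz[a Ka].
  exists (absz (a %% (p ^ m.+1)%N)%Z).
  rewrite pmulrn gez0_abs ?modz_ge0 ?eqz_nat -?lt0n //.
  rewrite {1}(divz_eq a (p ^ m.+1)%N) mulrzDr mulrC mulrzA -pmulrn zm in Ka.
  by rewrite mul0rz add0r in Ka.
- move=> k Kk Uzk.
  have Mzk : M (z - k).
    by apply: UM; split => //; apply: (sgB sgV) => //; exact: KV.
  apply: Kw; rewrite -[z](subrK k) mulrnDl; apply: (sgD sgK); last exact: sgMn.
  by apply/K0K/MK0.
Qed.

End Filtration.

(** * Iterated splitting *)

Record splitting_tower (P : zmodType) (U : nat -> set P) (V : nat -> set P)
    (z : nat -> P) (N : nat -> nat) : Prop := {
  tower_admissible : forall s, admissible U (V s);
  tower_split : forall s, splits_off U (V s) (V s.+1) (z s) (N s);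
  tower_small : forall n, exists s, V s `<=` U n }.

Lemma logn2_unbounded n k : exists2 s, (k <= s)%N & logn 2 s = n.
Proof.
exists (2 ^ n * k.*2.+1)%N.
  apply: leq_trans (leq_pmull _ _); last by rewrite expn_gt0.
  by rewrite -addnn; apply: leqW; exact: leq_addr.
rewrite lognM ?expn_gt0 // pfactorK // logn_coprime ?addn0 //.
by rewrite coprime2n /= odd_double.
Qed.

(** At stage [s] the split is made with respect to [U n] for [n = logn 2 s], so
that every [n] comes up infinitely often.  If no [V s] is inside [U n], each of
these stages yields some [y] in [V s] that is not in [V s.+1 + U n].  Two of
these elements that are close modulo [U n] to a common adherent point
contradict each other, the later one being in [V s.+1]. *)
Lemma exists_splitting_tower (P : zmodType) (U : nat -> set P) (H : set P) :
    compact_filtration U -> admissible U H ->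
  exists V z N, V 0%N = H /\ splitting_tower U V z N.
Proof.
move=> filtU admH.
pose shrinks (A K : set P) n :=
  A `<=` U n \/ exists2 y, A y & forall k, K k -> ~ U n (y - k).
have step (A : set P * nat) : exists B : set P * P * nat, admissible U A.1 ->
    [/\ admissible U B.1.1, splits_off U A.1 B.1.1 B.1.2 B.2
      & shrinks A.1 B.1.1 A.2].
  have [admA|nadmA] := pselect (admissible U A.1); last first.
    by exists (A.1, 0, 0%N).
  have [AU|AU] := pselect (A.1 `<=` U A.2).
    exists (A.1, 0, 0%N) => _ /=; split=> //; last by left.
    split => //=; first exact: sg0 (adm_subgroup admA).
    - by exists 0%N => x [].
    - by move=> x Ax; exists 0%N; rewrite mulr0n subr0.
  have [K [z [N [admK splitK zK]]]] := split_step filtU admA AU.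
  exists (K, z, N) => _; split => //; right; exists z => //.
  exact: split_mem splitK.
have [f fP] := choice step.
pose V := fix V s : set P := if s is t.+1 then (f (V t, logn 2 t)).1.1 else H.
pose z s := (f (V s, logn 2 s)).1.2.
pose N s := (f (V s, logn 2 s)).2.
have admV s : admissible U (V s).
  by elim: s => [//|s IHs]; have [] := fP (V s, logn 2 s) IHs.
have splitV s : splits_off U (V s) (V s.+1) (z s) (N s).
  by have [] := fP (V s, logn 2 s) (admV s).
have shrinkV s : shrinks (V s) (V s.+1) (logn 2 s).
  by have [] := fP (V s, logn 2 s) (admV s).
have decV s t : (s <= t)%N -> V t `<=` V s.
  by apply: chain_subset => k; exact: split_sub (splitV k).
exists V, z, N; split => //; split => // n.
apply: contrapT => Vlarge.
pose F k := [set y | exists s,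
  [/\ (k <= s)%N, V s y & forall x, V s.+1 x -> ~ U n (y - x)]].
have [k|i j ij y [s [js Vy yV]]|x xP] := filt_compact filtU (F := F).
- have [s ks sn] := logn2_unbounded n k.
  have := shrinkV s; rewrite sn => -[VU|[y Vy yV]].
    by case: Vlarge; exists s.
  by exists y, s.
- by exists s; split => //; exact: leq_trans js.
have close k : exists2 y, F k y & U n (x - y).
  have [y [s [ks Vy yV]] Uxy] := xP (maxn n k).
  exists y; last by apply: (filt_decreasing filtU) Uxy; rewrite leq_maxl.
  by exists s; split => //; apply: leq_trans ks; rewrite leq_maxr.
have [y [s [_ _ yV]] Uxy] := close 0%N.
have [y' [s' [ss' Vy' _]] Uxy'] := close s.+1.
apply: (yV y'); first exact: (decV s.+1 s').
have -> : y - y' = (x - y') - (x - y) by rewrite opprB [RHS]addrC subrKA.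
exact: (sgB (filt_subgroup filtU n)).
Qed.

(** * Expansion of an element along a tower *)

Section Expansion.
Variables (P : zmodType) (U : nat -> set P).
Variables (V : nat -> set P) (z : nat -> P) (N : nat -> nat).
Hypothesis filtU : compact_filtration U.
Hypothesis towerV : splitting_tower U V z N.

Let splitV := tower_split towerV.
Let sgV s := adm_subgroup (tower_admissible towerV s).

Definition partial_sum (c : nat -> nat) s := \sum_(k < s) z k *+ c k.

(** As [V s] tends to zero, this says that [x] is the sum of the series of the
[z k *+ c k]; the sharper form, with the remainder in [V s], makes the
coefficients unique. *)
Definition expansion (x : P) (c : nat -> nat) :=
  forall s, V s (x - partial_sum c s).

Lemma partial_sumS c s : partial_sum c s.+1 = partial_sum c s + z s *+ c s.
Proof. exact: big_ord_recr. Qed.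

Lemma tower_decreasing s t : (s <= t)%N -> V t `<=` V s.
Proof. by apply: chain_subset => k; exact: split_sub (splitV k). Qed.

Lemma tower_open s : exists r, V 0%N `&` U r `<=` V s.
Proof.
elim: s => [|s [r rV]]; first by exists 0%N => x [].
have [r' r'V] := split_open (splitV s).
exists (maxn r r') => x [V0x Ux]; apply: r'V; split.
  apply: rV; split => //.
  by apply: (filt_decreasing filtU) Ux; rewrite leq_maxl.
by apply: (filt_decreasing filtU) Ux; rewrite leq_maxr.
Qed.

Lemma tower_separated x : (forall s, V s x) -> x = 0.
Proof.
move=> Vx; apply: (filt_separated filtU) => n.
by have [s VU] := tower_small towerV n; exact: VU.
Qed.

Lemma mulrn_eqmod s a b : a = b %[mod (N s).+1] -> z s *+ a = z s *+ b.
Proof.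
have red c : z s *+ c = z s *+ (c %% (N s).+1).
  by rewrite {1}(divn_eq c (N s).+1) mulrnDr mulnC mulrnA
    (split_tors (splitV s)) mul0rn add0r.
by move=> ab; rewrite red ab -red.
Qed.

Lemma partial_sum_tail c s t :
  (s <= t)%N -> V s (partial_sum c t - partial_sum c s).
Proof.
move=> /subnK <-; elim: (t - s)%N => [|k IHk].
  by rewrite add0n subrr; exact: (sg0 (sgV s)).
rewrite addSn partial_sumS addrAC; apply: (sgD (sgV s)) => //.
apply: (sgMn (sgV s)); apply: (@tower_decreasing s (k + s)%N).
  exact: leq_addl.
exact: split_mem (splitV _).
Qed.

Lemma partial_sum_eqmod c d s :
    (forall k, (k < s)%N -> c k = d k %[mod (N k).+1]) ->
  partial_sum c s = partial_sum d s.
Proof. by move=> cd; apply: eq_bigr => k _; exact/mulrn_eqmod/cd. Qed.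

(** The sum of [V s.+1] and [<z s>] is direct, so the coefficients can be compared
one after the other. *)
Lemma digits_unique c d s : V s (partial_sum c s - partial_sum d s) ->
  forall k, (k < s)%N -> c k = d k %[mod (N k).+1].
Proof.
elim: s => // s IHs Vs.
have {}IHs : forall k, (k < s)%N -> c k = d k %[mod (N k).+1].
  apply: IHs; have := split_sub (splitV s) Vs.
  rewrite !partial_sumS opprD addrACA => Vs'.
  have Vz a : V s (z s *+ a).
    by apply: (sgMn (sgV s)); exact: split_mem (splitV s).
  rewrite -[_ - _](addrK (z s *+ c s - z s *+ d s)).
  by do 2?apply: (sgB (sgV s)).
move=> k; rewrite ltnS leq_eqVlt => /orP[/eqP ->{k}|]; last exact: IHs.
move: Vs; rewrite !partial_sumS (partial_sum_eqmod IHs) opprD addrACA subrr.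
rewrite add0r => Vs.
have le_eqmod a b : (a <= b)%N -> V s.+1 (z s *+ b - z s *+ a) ->
    b = a %[mod (N s).+1].
  move=> ab; rewrite -mulrnBr // => /(split_meet (splitV s)) dvd.
  by apply/eqP; rewrite eqn_mod_dvd.
have [cd|/ltnW dc] := leqP (c s) (d s); last exact: le_eqmod.
apply/esym/le_eqmod => //.
by rewrite -opprB; exact: (sgN (sgV _)).
Qed.

Lemma expansion_digits x : V 0%N x -> exists c, expansion x c.
Proof.
move=> V0x.
have digit (q : nat * P) : exists a, V q.1 q.2 -> V q.1.+1 (q.2 - z q.1 *+ a).
  have [/(split_sum (splitV q.1))[a Va]|nV] := pselect (V q.1 q.2).
    by exists a.
  by exists 0%N.
have [g gP] := choice digit.
pose r := fix r s : P := if s is t.+1 then r t - z t *+ g (t, r t) else x.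
exists (fun s => g (s, r s)) => s.
have -> : x - partial_sum (fun t => g (t, r t)) s = r s.
  elim: s => [|s IHs]; first by rewrite /partial_sum big_ord0 subr0.
  by rewrite partial_sumS opprD addrA IHs.
by elim: s => [//|s IHs]; exact: (gP (s, r s)).
Qed.

(** The partial sums form a Cauchy sequence; compactness provides a limit, and the
remainders stay in [V s] because [V s] is closed. *)
Lemma expansion_point c : exists2 x, V 0%N x & expansion x c.
Proof.
pose F s := [set x | V 0%N x /\ forall t, (t <= s)%N ->
  V t (x - partial_sum c t)].
have [s|i j ij y [V0y Vy]|x xP] := filt_compact filtU (F := F).
- exists (partial_sum c s); split; last by move=> t; exact: partial_sum_tail.
  have := partial_sum_tail c (leq0n s).
  by rewrite [partial_sum c 0]big_ord0 subr0.
- by split => // t ti; apply: Vy; exact: leq_trans ij.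
exists x.
  apply: (adm_closed (tower_admissible towerV 0%N)) => n.
  by have [y [V0y _] Uxy] := xP n; exists y.
move=> s; apply: (adm_closed (tower_admissible towerV s)) => n.
have [y [_ Vy] Uxy] := xP (maxn n s).
exists (y - partial_sum c s); first by apply: Vy; rewrite leq_maxr.
by rewrite opprB subrKA; apply: (filt_decreasing filtU) Uxy; rewrite leq_maxl.
Qed.

Lemma expansion_inj x y c : expansion x c -> expansion y c -> x = y.
Proof.
move=> xc yc; apply/subr0_eq/tower_separated => s.
have -> : x - y = (x - partial_sum c s) - (y - partial_sum c s).
  by rewrite opprB subrKA.
by apply: (sgB (sgV s)); [exact: xc | exact: yc].
Qed.

Lemma expansion_eqmod x c d : expansion x c ->
  (forall k, c k = d k %[mod (N k).+1]) -> expansion x d.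
Proof.
move=> xc cd s; rewrite -(@partial_sum_eqmod c d s) => [|k _]; first exact: xc.
exact: cd.
Qed.

(** This one equivalence gives the uniqueness of the coefficients and the
continuity of the expansion in both directions. *)
Lemma expansion_close x y c d s : expansion x c -> expansion y d ->
  V s (x - y) <-> forall k, (k < s)%N -> c k = d k %[mod (N k).+1].
Proof.
move=> xc yd.
have xyE : x - y = (x - partial_sum c s) - (y - partial_sum d s)
                   + (partial_sum c s - partial_sum d s).
  by rewrite opprB [in RHS]addrACA subrK [partial_sum d s - y]addrC addrK.
split=> [Vxy|cd].
  apply: digits_unique.
  rewrite -[_ - _](addKr ((x - partial_sum c s) - (y - partial_sum d s))) -xyE.
  apply: (sgD (sgV s)) => //; apply: (sgN (sgV s)).
  by apply: (sgB (sgV s)); [exact: xc | exact: yd].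
rewrite xyE; apply: (sgD (sgV s)).
  by apply: (sgB (sgV s)); [exact: xc | exact: yd].
by rewrite (partial_sum_eqmod cd) subrr; exact: (sg0 (sgV s)).
Qed.

Lemma expansion_add x y c d e : expansion x c -> expansion y d ->
    (forall k, e k = c k + d k %[mod (N k).+1])%N ->
  expansion (x + y) e.
Proof.
move=> xc yd ecd s.
have -> : partial_sum e s = partial_sum c s + partial_sum d s.
  rewrite -big_split; apply: eq_bigr => k _ /=.
  by rewrite (mulrn_eqmod (ecd k)) mulrnDr.
by rewrite opprD addrACA; apply: (sgD (sgV s)); [exact: xc | exact: yd].
Qed.

End Expansion.

(** * The filtration of a countable product of finite groups *)

Section ProductFiltration.
Variables (I : Type) (G : I -> finZmodType) (e : I -> nat).
Hypothesis e_inj : injective e.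

Definition vanishing_below n : set (direct_prod G) :=
  [set h | forall i, (e i < n)%N -> h i = 0 :> G i].

Lemma direct_prodBE (x y : direct_prod G) i : (x - y) i = (x i : G i) - y i.
Proof. by []. Qed.

Lemma direct_prodMnE (x : direct_prod G) n i : (x *+ n) i = (x i : G i) *+ n.
Proof.
elim: n => [|n IHn]; first by rewrite !mulr0n.
by rewrite !mulrS -IHn.
Qed.

Lemma vanishing_belowB n (x y : direct_prod G) :
  vanishing_below n (x - y) <-> forall i, (e i < n)%N -> x i = y i.
Proof.
split=> xy i /xy; rewrite direct_prodBE; first exact: subr0_eq.
by move->; rewrite subrr.
Qed.

Lemma nbhs_coordinate (x : direct_prod G) i : nbhs x [set y | y i = x i].
Proof.
have := @proj_continuous {classic I} (fun i => discrete_topology (G i)) i x.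
by move/(_ _ (@discrete_set1 (discrete_topology (G i)) (x i))).
Qed.

(** Injectivity of [e] makes every [vanishing_below n] a condition on finitely
many coordinates, hence a neighbourhood of zero; the converse is the universal
property of the product topology, applied to the filter of these cosets. *)
Lemma nbhs_direct_prodP (x : direct_prod G) (A : set (direct_prod G)) :
  nbhs x A <-> exists n, forall y, vanishing_below n (x - y) -> A y.
Proof.
split=> [|[n nA]]; last first.
  have : nbhs x [set y | vanishing_below n (x - y)].
    elim: n {nA} => [|n IHn]; first exact: filterS filterT.
    have [[i ein]|noi] := pselect (exists i, e i = n).
      apply: filterS2 IHn (nbhs_coordinate x i) => y /= Uxy yi j.
      rewrite ltnS leq_eqVlt => /orP[/eqP ejn|]; last exact: Uxy.
      have -> : j = i by apply: e_inj; rewrite ejn.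
      by rewrite direct_prodBE yi subrr.
    apply: filterS IHn => y /= Uxy j.
    rewrite ltnS leq_eqVlt => /orP[/eqP ejn|]; last exact: Uxy.
    by case: noi; exists j.
  by apply: filterS => y; exact: nA.
pose F := filter_from setT (fun n => [set y | vanishing_below n (x - y)]).
have FF : Filter F.
  apply: filter_from_filter; first by exists 0%N.
  move=> i j _ _; exists (maxn i j) => // y /= Uxy; split=> k ek; apply: Uxy.
    by rewrite (leq_trans ek) // leq_maxl.
  by rewrite (leq_trans ek) // leq_maxr.
have Fx : F --> x.
  apply/cvg_sup => i B [_ [[W _ <-] Wx WB]].
  exists (e i).+1 => // y /= /vanishing_belowB xy; apply: WB.
  by rewrite /= -(xy i).
by move=> /Fx[n _ nA]; exists n => y /nA.
Qed.

Lemma vanishing_below_exponent n :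
  exists2 N, (0 < N)%N & forall x, vanishing_below n (x *+ N).
Proof.
elim: n => [|n [N N0 UN]]; first by exists 1%N.
have [[i ein]|noi] := pselect (exists i, e i = n).
  exists (N * #|G i|)%N.
    by rewrite muln_gt0 N0; apply/card_gt0P; exists 0.
  move=> x j; rewrite ltnS leq_eqVlt => /orP[/eqP ejn|ejn].
    have -> : j = i by apply: e_inj; rewrite ejn.
    rewrite direct_prodMnE mulnC mulrnA.
    suff -> : (x i : G i) *+ #|G i| = 0 by rewrite mul0rn.
    have := @expg_cardG (G i) [set: G i]%G (x i).
    by rewrite inE cardsT FinRing.zmodXgE => ->.
  by rewrite mulrnA direct_prodMnE UN // mul0rn.
exists N => // x j; rewrite ltnS leq_eqVlt => /orP[/eqP ejn|]; last exact: UN.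
by case: noi; exists j.
Qed.

Lemma direct_prod_compact : compact [set: direct_prod G].
Proof.
have cptG (i : {classic I}) : compact [set: discrete_topology (G i)].
  exact/finite_compact/finite_finset.
have := tychonoff cptG.
by congr compact; apply/seteqP; split.
Qed.

(** The compactness clause is the existence of a cluster point of the filter
generated by the [F n], which Tychonoff's theorem provides. *)
Lemma product_filtration : compact_filtration vanishing_below.
Proof.
split.
- move=> n; split; first by [].
  by move=> x y Ux Uy i ein; rewrite direct_prodBE Ux // Uy // subrr.
- by move=> m n mn x Ux i eim; apply: Ux; exact: leq_trans mn.
- move=> x Ux; apply: functional_extensionality_dep => i.
  exact: (Ux (e i).+1).
- exact: vanishing_below_exponent.
move=> F F0 decF.
have FF : ProperFilter (filter_from setT F).
  apply: filter_from_proper => [|n _]; last exact: F0.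
  apply: filter_from_filter; first by exists 0%N.
  move=> i j _ _; exists (maxn i j) => // x Fx.
  by split; apply: decF Fx; rewrite ?leq_maxl ?leq_maxr.
have [x [_ clx]] := direct_prod_compact FF filterT.
exists x => n.
have [||y [Fy Uxy]] := clx (F n) [set y | vanishing_below n (x - y)].
- by exists n.
- by apply/nbhs_direct_prodP; exists n.
by exists y.
Qed.

(** A finite support is bounded by some [b], and all the coordinates below [b] have
a common exponent. *)
Lemma direct_sum_torsion (d : direct_prod G) : direct_sum G d ->
  exists2 N, (0 < N)%N & d *+ N = 0.
Proof.
move=> /(finite_image e)/finite_seqP[t tE].
pose b := (\max_(k <- t) k).+1.
have bP i : d i <> 0 :> G i -> (e i < b)%N.
  move=> di; rewrite ltnS (leq_bigmax_seq (e i)) //.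
  have : (e @` [set i | d i <> 0 :> G i]) (e i) by exists i.
  by rewrite tE.
have [N N0 UN] := vanishing_below_exponent b.
exists N => //; apply: functional_extensionality_dep => i.
have [eib|bei] := ltnP (e i) b; first exact: UN.
rewrite direct_prodMnE; have -> : d i = 0 :> G i; last exact: mul0rn.
by apply: contrapT => /bP; rewrite ltnNge bei.
Qed.

Lemma nbhs_subgroupP (H : subgroup (direct_prod G)) (x : subgroup_type H)
    (A : set (subgroup_type H)) :
  nbhs x A <->
    exists n, forall y, vanishing_below n (val x - val y) -> A y.
Proof.
split=> [[_ [[W oW <-] Wx WA]]|[n nA]].
  have /nbhs_direct_prodP[n nW] : nbhs (set_val x : direct_prod G) W.
    exact: open_nbhs_nbhs.
  by exists n => y /nW Wy; exact: WA.
have Ux : nbhs (set_val x : direct_prod G)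
    [set y | vanishing_below n (val x - y)].
  by apply/nbhs_direct_prodP; exists n.
have := @initial_continuous _ _
  (set_val : set_type (H : set (direct_prod G)) -> direct_prod G) x _ Ux.
exact: (@filterS _ (nbhs (x : subgroup_type H)) _ _ _ (fun y => @nA y)).
Qed.

Lemma weakly_controllable_admissible (H : subgroup (direct_prod G)) :
  closed (H : set (direct_prod G)) -> weakly_controllable H ->
  admissible vanishing_below (H : set (direct_prod G)).
Proof.
move=> closedH denseH.
have [H0 HB] := subgroup_closed H.
split.
- split; first exact: set_mem.
  by move=> x y /mem_set Hx /mem_set Hy; apply: set_mem; exact: HB.
- move=> v n /mem_set Hv.
  pose A : set (subgroup_type H) :=
    [set y | vanishing_below n (v - val y)].
  have oA : open A.
    rewrite openE => y Ay; apply/nbhs_subgroupP; exists n => y' Uyy'.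
    rewrite /A /= -[v - _](subrKA (val y)).
    apply: (sgD (filt_subgroup product_filtration n)) => //.
  have [|d [Ad Sd]] := denseH A _ oA.
    exists (exist _ v Hv : subgroup_type H) => /=.
    by rewrite /A /= subrr; exact: (sg0 (filt_subgroup product_filtration n)).
  exists (val d); split => //; first by apply: set_mem; exact: valP.
  exact: direct_sum_torsion.
- move=> x adhx; apply: closedH => A /nbhs_direct_prodP[n nA].
  by have [y Hy /nA Ay] := adhx n; exists y.
Qed.

End ProductFiltration.

(** * The isomorphism *)

Theorem corollary9p1 (I : Type) (hI : countable [set: I])
    (G : I -> finZmodType) (H : subgroup (direct_prod G))
    (hclosed : closed (H : set (direct_prod G)))
    (hctrl : weakly_controllable H) :
  exists (J : Type) (C : J -> finZmodType),
    (forall j : J, cyclic [set: C j]%SET) /\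
    topologically_isomorphic (subgroup_type H) (direct_prod C).
Proof.
have [e e_inj'] := countable_injP _ hI.
have e_inj : injective e by move=> i j; apply: e_inj'; exact: in_setT.
have filtU := product_filtration G e_inj.
have admH := weakly_controllable_admissible e_inj hclosed hctrl.
have [V [z [N [V0 towerV]]]] := exists_splitting_tower filtU admH.
have idI : injective (@id nat) := @inj_id nat.
pose C (j : nat) : finZmodType := 'I_(N j).+1.
exists nat, C; split.
  by move=> j; apply/cyclicP; exists Zp1; exact: Zp_cycle.
pose rel (x : subgroup_type H) (c : direct_prod C) :=
  expansion V z (val x) (fun k => (c k : 'I_(N k).+1)).
have rel_close x y c d s : rel x c -> rel y d ->
    V s (val x - val y) <-> vanishing_below (G := C) id s (c - d).
  move=> xc yd; have close := expansion_close towerV s xc yd.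
  split=> [/close cd|/vanishing_belowB cd].
    apply/vanishing_belowB => k /cd; rewrite !modn_small ?ltn_ord // => ckdk.
    exact: ord_inj.
  by apply/close => k /cd ->.
have V0H x : V 0%N x <-> (H : set _) x by rewrite V0.
have [f fP] : {f : subgroup_type H -> direct_prod C & forall x, rel x (f x)}.
  apply: choice => x.
  have [c xc] : exists c, expansion V z (val x) c.
    by apply: (expansion_digits towerV); apply/V0H/set_mem; exact: valP.
  exists (fun k => inZp (c k) : 'I_(N k).+1).
  by apply: (expansion_eqmod towerV xc) => k /=; rewrite modn_mod.
have [g gP] : {g : direct_prod C -> subgroup_type H & forall c, rel (g c) c}.
  apply: (@choice _ _ (fun c x => rel x c)) => c.
  have [x /V0H/mem_set Hx xc] :=
    expansion_point filtU towerV (fun k => (c k : 'I_(N k).+1)).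
  by exists (exist _ x Hx).
have digits_inj x c d : rel x c -> rel x d -> c = d.
  move=> xc xd; apply/subr0_eq.
  apply: (filt_separated (product_filtration C idI)) => s.
  apply/(rel_close x x) => //; rewrite subrr.
  exact: (sg0 (adm_subgroup (tower_admissible towerV s))).
have fK : cancel f g.
  by move=> x; apply/val_inj/(expansion_inj filtU towerV (gP (f x)))/fP.
have gK : cancel g f by move=> c; exact: (digits_inj (g c)).
have fadd : {morph f : x y / x + y}.
  move=> x y; apply: (digits_inj (x + y)) => //.
  by apply: (expansion_add towerV (fP x) (fP y)) => k /=; rewrite modn_mod.
have f0 : f 0 = 0 by apply: (addrI (f 0)); rewrite -fadd !addr0.
pose additivity := GRing.isNmodMorphism.Build _ _ f (conj f0 fadd).
pose fA : {additive subgroup_type H -> direct_prod C} := HB.pack f additivity.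
exists fA, g.
split => //.
- move=> x A /(nbhs_direct_prodP idI)[n nA].
  have [r rV] := tower_open filtU towerV n.
  apply/(nbhs_subgroupP e_inj); exists r => y Uxy; apply: nA.
  apply/(rel_close x y) => //; apply: rV; split => //.
  apply/V0H/set_mem; case: (subgroup_closed H) => _ subrH.
  by apply: subrH; exact: valP.
- move=> c A /(nbhs_subgroupP e_inj)[n nA].
  have [s VU] := tower_small towerV n.
  apply/(nbhs_direct_prodP idI); exists s => d Ucd; apply: nA; apply: VU.
  exact/(rel_close _ _ c d).
Qed.
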